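(* There exists a constant $C\in\mathbb{R}^+$ such that for any $0<\varepsilon<1/2$, any desired false positive rate $\varphi\in(0,1]$, and $r\ge 1$ the closest integer to $-\log_2(\varphi)$, the following holds. For any $w\in\mathbb{N}$ with $\varepsilon w>C\max(\log w,\,r)$ and any $n\in\mathbb{N}$, the Homogeneous Ribbon filter with $n$ keys and parameters $\varepsilon,w,r$ has false positive rate $f\in[\varphi/2,\,2\varphi]$ and space overhead at most $2\varepsilon$.
   Context: All arithmetic on bits is over the two-element field $\mathbb{F}_2$; $[k]=\{1,\dots,k\}$. Homogeneous Ribbon filter with $n$ keys and parameters $\varepsilon,w,r$. Let $\mathcal{U}$ be a universe of keys and $S\subseteq\mathcal{U}$ a set of $n$ keys with $\mathcal{U}\setminus S\ne\emptyset$. Let $m=(1+\varepsilon)n$, i.e. $\varepsilon=\frac{m-n}{n}$ (with $m$ an integer and $m\ge w$, so that the construction makes sense). Each key $x\in\mathcal{U}$ is assigned by a hash function a starting position $s(x)$ uniform in $[m-w+1]$ and a coefficient vector $c(x)$ uniform in $\{0,1\}^w$, all independent, also across keys. Put $\vec h(x)=0^{s(x)-1}\,c(x)\,0^{m-s(x)-w+1}\in\{0,1\}^m$ (a row vector). The filter stores a matrix $Z\in\{0,1\}^{m\times r}$ chosen uniformly at random among all solutions of the homogeneous linear system $\vec h(x)\cdot Z=0^r$ for all $x\in S$. A membership query for $y\in\mathcal{U}$ returns true if and only if $\vec h(y)\cdot Z=0^r$. False positive rate: for given $Z$, $f_Z=\Pr_{a\sim H}[a\cdot Z=0^r]$, where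 $H$ is the distribution of $\vec h(y)$ for a key $y$ and $a$ is independent of $Z$; the false positive rate is $f=\mathbb{E}[f_Z]$, the expectation being over $(\vec h(x))_{x\in S}$ and the random choice of $Z$. Equivalently $f=\Pr[\vec h(y)\cdot Z=0^r]$ for $y\in\mathcal{U}\setminus S$. Space overhead: $\frac{\mathrm{SPACE}}{\mathrm{OPT}}-1$, where $\mathrm{SPACE}=\frac{mr}{n}=(1+\varepsilon)r$ is the space usage of the filter (the bits of $Z$) in bits per key and $\mathrm{OPT}=-\log_2(f)$. *)

(* Defs.v *)
From mathcomp Require Import all_boot all_order all_algebra finmap.
From mathcomp Require Import all_classical all_reals all_analysis.

Set Implicit Arguments.
Unset Strict Implicit.
Unset Printing Implicit Defensive.

Import Order.TTheory GRing.Theory Num.Theory.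

Local Open Scope ring_scope.

Definition log2 (R : realType) (x : R) : R := ln x / ln 2.

(* Ties are allowed. The minimum is over positive integers only, so that every
   x >= 0 (also x < 1/2) has a closest one. *)
Definition closest_posint (R : realType) (x : R) (r : nat) : Prop :=
  (0 < r)%N /\
  forall k : nat, (0 < k)%N -> `|r%:R - x| <= `|k%:R - x|.

(* Expectation of F under the uniform distribution on the finite set A. *)
Definition unifE (R : realType) (T : finType) (A : {set T}) (F : T -> R) : R :=
  (\sum_(t in A) F t) / #|A|%:R.

Definition unifPr (R : realType) (T : finType) (A : {set T}) (E : pred T) : R :=
  unifE A (fun t => (E t)%:R : R).

(* Hash value (s(x), c(x)) of a key; positions are counted from 0, so s(x)
   ranges over {0, ..., m - w}. *)
Definition hash (m w : nat) : finType := ('I_(m - w).+1 * 'rV['F_2]_w)%type.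

(* The row 0^s c 0^(m - s - w): entry k of c is put at index s + k. *)
Definition hvec (m w : nat) (sc : hash m w) : 'rV['F_2]_m :=
  \row_(j < m) \sum_(k < w | (sc.1 + k == j)%N) sc.2 0 k.

Definition query (m r : nat) (Z : 'M['F_2]_(m, r)) (a : 'rV['F_2]_m) : bool :=
  a *m Z == 0.

Definition solutions (m w r : nat) (K : finType) (h : {ffun K -> hash m w}) :
    {set 'M['F_2]_(m, r)} :=
  [set Z | [forall x : K, hvec (h x) *m Z == 0]].

(* f_Z: the vector a = h(y) of a fresh key y, independent of Z. *)
Definition fpr_given (R : realType) (m w r : nat) (Z : 'M['F_2]_(m, r)) : R :=
  unifPr R [set: hash m w] (fun sc => query Z (hvec sc)).

(* f = E[f_Z]. Independent uniform hash values for the keys in S amount to a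
   uniformly random function on S; given these, Z is uniform among the
   solutions (there is always one, Z = 0). *)
Definition fpr (R : realType) (U : choiceType) (S : {fset U}) (m w r : nat) : R :=
  unifE [set: {ffun S -> hash m w}] (fun h =>
    unifE (solutions r h) (fun Z => fpr_given R w Z)).

Definition space (R : realType) (n m r : nat) : R := (m * r)%:R / n%:R.

Definition opt (R : realType) (f : R) : R := - log2 f.

Definition overhead (R : realType) (n m r : nat) (f : R) : R :=
  space R n m r / opt f - 1.

(* Main.v *)
Require Import Defs.
From mathcomp Require Import all_boot all_order all_algebra finmap.
From mathcomp Require Import all_classical all_reals all_analysis.
From mathcomp Require Import zify ring lra.

Set Implicit Arguments.
Unset Strict Implicit.
Unset Printing Implicit Defensive.

Import Order.TTheory GRing.Theory Num.Theory.

Local Open Scope ring_scope.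

(** If h(y) is not in the span of the h(x), x in S, then h(y) Z is uniform, so
    2^-r <= f <= 2^-r + p, where p is the probability that h(y) lies in this
    span.  It remains to show that p is tiny compared with eps 2^-r.

    If h(y) lies in the span, take a minimal set A of keys containing y whose
    rows sum to 0.  The windows [s(x), s(x) + w) of the keys of A cover an
    interval [a, a + l + w), where a and a + l are the extreme starting
    positions in A: otherwise A could be split at a gap.  For fixed starting
    positions such a set A sums to 0 with probability at most 2^-(l+w), so by a
    union bound p is at most the sum over a and l of the expectation of
    [s(y) in [a, a+l]] min(1, 2^(N-l-w)), where N is the number of keys,
    including y, that start in [a, a + l].  The minimum is at most
    exp(eta (N-l-w)) for 0 <= eta <= ln 2, and a Chernoff bound with a suitable
    tilt eta for each l gives p = O(eps^-4 exp(- eps w / 64)). *)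

(* (v, t) |-> g v t is injective on V * A, since f recovers v. *)
Lemma leq_card_section (T V : finType) (A B : {set T}) (f : T -> V)
    (g : V -> T -> T) :
  (forall v, injective (g v)) ->
  (forall v t, t \in A -> g v t \in B /\ f (g v t) = v) ->
  (#|A| * #|V| <= #|B|)%N.
Proof.
move=> g_inj gP.
have -> : (#|A| * #|V| = #|finset.setX A [set: V]|)%N by rewrite cardsX cardsT.
have inj : {in finset.setX A [set: V] &, injective (fun u : T * V => g u.2 u.1)}.
  move=> [t v] [t' v']; rewrite !inE /= !andbT => tA t'A e.
  have [_ e1] := gP v t tA; have [_ e2] := gP v' t' t'A.
  have ev : v = v' by rewrite -e1 -e2 e.
  by move: e; rewrite -ev => /g_inj ->.
rewrite -(card_in_imset inj); apply/subset_leq_card/fintype.subsetP => u /imsetP[[t v]].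
rewrite !inE /= andbT => tA -> {u}; by have [] := gP v t tA.
Qed.

Lemma card_rowF2 (w : nat) : #|{: 'rV['F_2]_w}| = (2 ^ w)%N.
Proof. by rewrite card_mx card_Fp // mul1n. Qed.

(** * Counting solutions of a homogeneous system over ['F_2] *)

Section Solutions.
Variables (m w r : nat) (K : finType) (h : {ffun K -> hash m w}).

(** Over ['F_2] the linear combinations are exactly the subset sums. *)
Definition in_span (a : 'rV['F_2]_m) : bool :=
  [exists T : {set K}, a == \sum_(x in T) hvec (h x)].

Lemma solutionsP (Z : 'M['F_2]_(m, r)) :
  reflect (forall x, hvec (h x) *m Z = 0) (Z \in solutions r h).
Proof. by rewrite inE; apply: (iffP forallP) => H x; apply/eqP. Qed.

Lemma solutions_gt0 : (0 < #|solutions r h|)%N.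
Proof. by apply/card_gt0P; exists 0; apply/solutionsP => x; rewrite mulmx0. Qed.

(** The columns of the cokernel of the matrix of rows kill every row; some column does not kill [a],
    and a nonzero element of ['F_2] is 1. *)
Lemma span_dual (a : 'rV['F_2]_m) : ~~ in_span a ->
  exists u : 'cV['F_2]_m, a *m u = 1 /\ forall x, hvec (h x) *m u = 0.
Proof.
move=> nspan.
pose A := \matrix_(i < #|K|) hvec (h (enum_val i)).
have nA : ~~ (a <= A)%MS.
  apply: contra nspan => /submxP[D ->]; apply/existsP.
  exists [set x | D 0 (enum_rank x) != 0]; apply/eqP.
  rewrite mulmx_sum_row (reindex_onto enum_rank enum_val) /=; last first.
    by move=> i _; rewrite enum_valK.
  rewrite [RHS]big_mkcond /=; apply: eq_big => [x|x _].
    by rewrite enum_rankK eqxx.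
  rewrite rowK enum_rankK inE.
  have [->|] := eqVneq (D 0 (enum_rank x)) 0; first by rewrite scale0r.
  case: (D _ _) => -[|[|]] //= lt _.
  by rewrite -[RHS]scale1r; congr (_ *: _); apply/val_inj.
have {nA} : a *m cokermx A != 0 by rewrite -submxE.
case/rV0Pn => j nz.
exists (col j (cokermx A)); split.
  apply/rowP => i; rewrite ord1 colE mulmxA -colE mxE.
  by move: nz; case: ((a *m _) 0 j) => -[|[|]] //= lt _; rewrite mxE eqxx; apply/val_inj.
move=> x; rewrite colE mulmxA -colE.
have -> : hvec (h x) = row (enum_rank x) A by rewrite rowK enum_rankK.
by rewrite -row_mul mulmx_coker row0 col0.
Qed.

(** Adding [u *m v], with [u] from [span_dual], moves a solution killed by [a] to a solution that
    [a] maps to [v], and there are 2^r choices of [v]. *)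
Lemma query_count_ub (a : 'rV['F_2]_m) : ~~ in_span a ->
  (#|[set Z in solutions r h | query Z a]| * 2 ^ r <= #|solutions r h|)%N.
Proof.
move=> /span_dual[u [au1 hu0]]; rewrite -card_rowF2.
apply: (@leq_card_section _ _ _ _ (fun Z => a *m Z) (fun v Z => Z + u *m v)).
  by move=> v Z Z' /addIr.
move=> v Z; rewrite inE => /andP[/solutionsP solZ /eqP qZ]; split.
  by apply/solutionsP => x; rewrite mulmxDr solZ mulmxA hu0 mul0mx addr0.
by rewrite mulmxDr qZ mulmxA au1 mul1mx add0r.
Qed.

(** Each of the 2^r fibres of Z |-> a Z on the solutions is empty or a translate of the fibre over
    0. *)
Lemma query_count_lb (a : 'rV['F_2]_m) :
  (#|solutions r h| <= #|[set Z in solutions r h | query Z a]| * 2 ^ r)%N.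
Proof.
rewrite -sum1_card (partition_big (fun Z => a *m Z) predT) //=.
rewrite -card_rowF2 mulnC -sum_nat_const; apply: leq_sum => v _.
rewrite sum1_card.
have [/existsP[Z0 /andP[s0 /eqP e0]]|/existsPn none] :=
    boolP [exists Z0 : 'M['F_2]_(m, r), 
      (Z0 \in solutions r h) && (a *m Z0 == v)]; last first.
  by rewrite eq_card0 // => Z; rewrite unfold_in; apply/negbTE/none.
have inj : injective (fun Z : 'M['F_2]_(m, r) => Z - Z0) by move=> Z Z' /addIr.
rewrite -(fintype.card_image inj).
apply/subset_leq_card/fintype.subsetP => Y /fintype.imageP[Z].
rewrite unfold_in => /andP[/solutionsP sZ /eqP eZ] -> {Y}; rewrite inE.
apply/andP; split; last by rewrite /query mulmxBr eZ e0 subrr.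
by apply/solutionsP => x; rewrite mulmxBr sZ (solutionsP _ s0) subrr.
Qed.

End Solutions.

(** * Windows and zero sums of rows for fixed starting positions *)

Definition window_coord (w s : nat) (c : 'rV['F_2]_w) (j : nat) : 'F_2 :=
  \sum_(k < w | (s + k == j)%N) c 0 k.

Lemma window_coord_out (w s : nat) (c : 'rV['F_2]_w) (j : nat) :
  ~~ (s <= j < s + w)%N -> window_coord s c j = 0.
Proof.
move=> out; apply: big_pred0 => k; apply/negbTE; apply: contra out => /eqP <-.
by have := ltn_ord k; lia.
Qed.

Lemma window_coordD (w s : nat) (c d : 'rV['F_2]_w) (j : nat) :
  window_coord s (c + d) j = window_coord s c j + window_coord s d j.
Proof. by rewrite -big_split; apply: eq_bigr => k _; rewrite mxE. Qed.

Lemma sum_hvecE (m w : nat) (T : finType) (A : {set T}) (g : T -> hash m w)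
    (j : 'I_m) :
  (\sum_(x in A) hvec (g x)) 0 j = \sum_(x in A) window_coord (g x).1 (g x).2 j.
Proof. by rewrite summxE; apply: eq_bigr => x _; rewrite mxE. Qed.

Section Circuit.
Variables (m w : nat) (T : finType) (s : T -> 'I_(m - w).+1).
Implicit Types (A : {set T}) (a l : nat).

Definition starts_in A a l := [forall x in A, (a <= s x <= a + l)%N].

Definition covers A a l :=
  [forall i : 'I_(l + w), [exists x in A, (s x <= a + i < s x + w)%N]].

Lemma circuit_covers (c : T -> 'rV['F_2]_w) (y : T) A0 :
  y \in A0 -> \sum_(x in A0) hvec (s x, c x) = 0 ->
  exists A (a l : 'I_(m - w).+1),
    [/\ y \in A, starts_in A a l, covers A a l
      & \sum_(x in A) hvec (s x, c x) = 0].
Proof.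
move=> yA0 sumA0.
pose dep A := (y \in A) && (\sum_(x in A) hvec (s x, c x) == 0).
have depA0 : dep A0 by rewrite /dep yA0 sumA0 eqxx.
have [A /andP[yA /eqP sumA] minA] := arg_minnP (fun A : {set T} => #|A|) depA0.
have [xa xaA minxa] := @arg_minnP _ y (fun x => x \in A) (fun x => s x : nat) yA.
have [xb xbA maxxb] := @arg_maxnP _ y (fun x => x \in A) (fun x => s x : nat) yA.
have lP : (s xb - s xa < (m - w).+1)%N by rewrite (leq_ltn_trans (leq_subr _ _)).
have leab : (s xa <= s xb)%N := minxa _ xbA.
exists A, (s xa), (Ordinal lP); split=> //=.
  by apply/forall_inP => x xA; have := minxa _ xA; have := maxxb _ xA; lia.
apply/forallP => i; apply: contraT => /existsPn gap.
have {}gap x : x \in A -> ~~ (s x <= s xa + i < s x + w)%N.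
  by move=> xA; have := gap x; rewrite xA.
set j := (s xa + i)%N in gap.
have j_lt : (j < s xb + w)%N by have := ltn_ord i; rewrite /j /=; lia.
(* No window contains j, so the rows of A on either side of j have disjoint
   supports, and both groups sum to 0. *)
pose A1 := [set x in A | (s x + w <= j)%N].
have sA1 : A1 \subset A by apply/fintype.subsetP => x; rewrite inE => /andP[].
have xaA1 : xa \in A1 by rewrite inE xaA /=; have := gap _ xaA; rewrite /j; lia.
have xbA1 : xb \notin A1 by rewrite inE xbA /=; lia.
have sumID : \sum_(x in A1) hvec (s x, c x) + \sum_(x in A :\: A1) hvec (s x, c x) = 0.
  by rewrite -[RHS]sumA [RHS](finset.big_setID A1) /= (finset.setIidPr sA1).
have sumA1 : \sum_(x in A1) hvec (s x, c x) = 0.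
  apply/rowP => q; rewrite [RHS]mxE.
  have [qj|jq] := ltnP q j; last first.
    rewrite sum_hvecE big1 // => x; rewrite inE => /andP[_ xj] /=.
    by apply: window_coord_out; lia.
  move/rowP/(_ q): sumID; rewrite mxE [in RHS]mxE (sum_hvecE (A :\: A1)).
  rewrite [X in _ + X]big1 ?addr0 // => x; rewrite !inE => /andP[nxj xA] /=.
  move: nxj; rewrite xA /= => nxj.
  by apply: window_coord_out; have := gap x xA; lia.
have sumA2 : \sum_(x in A :\: A1) hvec (s x, c x) = 0.
  by move: sumID; rewrite sumA1 add0r.
(* The left group misses [xb] and the right group misses [xa], so whichever contains [y] is a
   strictly smaller zero sum. *)
have [yA1|yA1] := boolP (y \in A1).
  have := minA A1; rewrite /dep yA1 sumA1 eqxx => /(_ isT).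
  rewrite leqNgt => /negP[]; apply: proper_card; apply/properP.
  by split=> //; exists xb.
have := minA (A :\: A1); rewrite /dep finset.in_setD yA1 yA sumA2 eqxx => /(_ isT).
rewrite leqNgt => /negP[]; apply: proper_card; apply/properP.
split; first exact: subsetDl.
by exists xa => //; rewrite !inE; rewrite inE in xaA1; rewrite xaA1.
Qed.

Lemma covers_count A a l : (w <= m)%N -> covers A a l ->
  (#|[set c : {ffun T -> 'rV['F_2]_w} | (\sum_(x in A) hvec (s x, c x) == 0)%R]|
     * 2 ^ (l + w) <= #|{: {ffun T -> 'rV['F_2]_w}}|)%N.
Proof.
move=> wm /forallP cov.
have /fin_all_exists[X XP] : forall i : 'I_(l + w),
    exists x, (x \in A) && (s x <= a + i < s x + w)%N.
  by move=> i; apply/existsP/cov.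
rewrite -[X in (_ <= X)%N]cardsT -card_rowF2.
(* Coordinate a + i of the sum takes any prescribed value v i by adding v i to
   the coefficient of X i at that position. *)
pose psi (v : 'rV['F_2]_(l + w)) (x : T) : 'rV['F_2]_w :=
  \row_k \sum_(i < l + w | (a + i == s x + k)%N && (x == X i)) v 0 i.
pose phi (c : {ffun T -> 'rV['F_2]_w}) :=
  \row_(i < l + w) \sum_(x in A) window_coord (s x) (c x) (a + i).
pose g v (c : {ffun T -> 'rV['F_2]_w}) := [ffun x => c x + psi v x].
refine (@leq_card_section _ _ _ _ phi g _ _).
  move=> v c c' /ffunP e; apply/ffunP => x; have := e x.
  by rewrite !ffunE => /addIr.
move=> v c; rewrite inE => /eqP /rowP sum0; split; first by rewrite inE.
apply/rowP => i; rewrite mxE.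
have /andP[XiA Xicov] := XP i.
(* The window of [X i] ends at m at the latest, so a + i is a genuine column index. *)
have im : (a + i < m)%N by have := ltn_ord (s (X i)); lia.
under eq_bigr do rewrite ffunE window_coordD.
rewrite big_split /=.
have := sum0 (Ordinal im); rewrite sum_hvecE mxE /= => ->; rewrite add0r.
have kP : (a + i - s (X i) < w)%N by lia.
(* At coordinate a + i the correction of [X i] is exactly [v 0 i], and that of any other key is
   0. *)
rewrite (bigD1 (X i)) //= [X in _ + X]big1 ?addr0 => [|x /andP[_ xi]].
  rewrite /window_coord (big_pred1 (Ordinal kP)) => [|k /=]; last first.
    by rewrite -val_eqE /= -(eqn_add2l (s (X i)) k) subnKC //; case/andP: Xicov.
  rewrite mxE (big_pred1 i) //= => i'.
  have [->|ni] := eqVneq i' i; first by rewrite /= subnKC ?eqxx //; case/andP: Xicov.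
  rewrite /= (negbTE ni); apply: contraNF ni => /andP[/eqP /= e _].
  apply/eqP/val_inj => /=; lia.
rewrite /window_coord big1 // => k /eqP ek; rewrite mxE big_pred0 // => i'.
apply/negbTE; apply/negP => /andP[/eqP e /eqP ex].
have ii : i' = i by apply/val_inj => /=; lia.
by move: xi; rewrite ex ii eqxx.
Qed.

End Circuit.

(** * Union bound over intervals and exponential moments of the starting positions *)

Definition starts_between (M a l : nat) (i : 'I_M) : bool := (a <= i <= a + l)%N.

Lemma card_starts_between (M a l : nat) :
  (#|[set i : 'I_M | starts_between a l i]| <= l.+1)%N.
Proof.
rewrite -[l.+1]card_ord -[#|'I_l.+1|]cardsT.
have inj : {in [set i : 'I_M | starts_between a l i] &,
    injective (fun i : 'I_M => inord (i - a) : 'I_l.+1)}.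
  move=> i j; rewrite !inE /starts_between => Hi Hj /(congr1 val) /=.
  by rewrite !inordK; try lia; move=> e; apply/val_inj => /=; lia.
by rewrite -(card_in_imset inj) subset_leq_card // finset.subsetT.
Qed.

Section Dependent.
Variables (m w : nat) (wm : (w <= m)%N) (T : finType) (y : T).
Let M := (m - w).+1.
Implicit Types (s : {ffun T -> 'I_M}) (c : {ffun T -> 'rV['F_2]_w}).

(** Over ['F_2] this says that the row of [y] lies in the span of the rows of the other keys; [y] is
    itself a member of [T], so that all positions are drawn together. *)
Definition dependent s c :=
  [exists A : {set T}, (y \in A) && (\sum_(x in A) hvec (s x, c x) == 0)].

Definition dependent_on a l s c := [exists A : {set T},
  [&& y \in A, starts_in s A a l, covers s A a l
    & \sum_(x in A) hvec (s x, c x) == 0]].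

Definition keys_near a l s : {set T} := [set x | starts_between a l (s x)].

Lemma dependent_onP s c : dependent s c ->
  exists a l : 'I_M, dependent_on a l s c.
Proof.
case/existsP => A /andP[yA /eqP sumA].
have [B [a [l [yB sB cB sumB]]]] := circuit_covers yA sumA.
by exists a, l; apply/existsP; exists B; rewrite yB sB cB sumB eqxx.
Qed.

Lemma dependent_on_keys_near a l s c : dependent_on a l s c ->
  starts_between a l (s y).
Proof. by case/existsP => A /and4P[yA /forall_inP sA _ _]; apply: sA. Qed.

(** Union bound over the subsets of [keys_near a l s], each handled by [covers_count]. *)
Lemma dependent_on_count a l s :
  (#|[set c | dependent_on a l s c]| * 2 ^ (l + w)
     <= 2 ^ #|keys_near a l s| * #|{: {ffun T -> 'rV['F_2]_w}}|)%N.
Proof.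
pose F (A : {set T}) :=
  [set c : {ffun T -> 'rV['F_2]_w} | (\sum_(x in A) hvec (s x, c x) == 0)%R].
pose P (A : {set T}) := (A \in powerset (keys_near a l s)) && covers s A a l.
have : (#|[set c | dependent_on a l s c]| <= \sum_(A | P A) #|F A|)%N.
  rewrite -sum1_card.
  under [X in (_ <= X)%N]eq_bigr do rewrite -sum1_card big_mkcond.
  rewrite exchange_big /= big_mkcond; apply: leq_sum => c _.
  case: ifP => //; rewrite inE => /existsP[A /and4P[_ /forall_inP sA cA zA]].
  have PA : P A.
    rewrite /P cA andbT inE; apply/fintype.subsetP => x xA; rewrite inE.
    exact: sA.
  by rewrite (bigD1 A) //= inE zA.
move=> le1; apply: leq_trans (leq_mul le1 (leqnn _)) _.
rewrite big_distrl /= -card_powerset -sum_nat_const.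
rewrite big_mkcond [X in (_ <= X)%N]big_mkcond; apply: leq_sum => A _.
rewrite /P; case: (A \in _) => //=; case: ifP => // cA.
exact: (covers_count wm cA).
Qed.

Variable R : realType.

Lemma dependent_on_sum (a l : nat) s (eta : R) : 0 <= eta <= ln 2 ->
  \sum_(c : {ffun T -> 'rV['F_2]_w}) (dependent_on a l s c)%:R <=
  #|{: {ffun T -> 'rV['F_2]_w}}|%:R * ((starts_between a l (s y))%:R
    * expR (eta * (#|keys_near a l s|%:R - (l + w)%:R))) :> R.
Proof.
move=> /andP[eta0 etaln].
have [sy|nsy] := boolP (starts_between a l (s y)); last first.
  rewrite mul0r mulr0 big1 // => c _.
  by rewrite (contraNF (@dependent_on_keys_near a l s c) nsy).
rewrite mul1r -natr_sum.
have -> : (\sum_(c : {ffun T -> 'rV['F_2]_w}) dependent_on a l s c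
    = #|[set c | dependent_on a l s c]|)%N.
  by rewrite -sum1_card [RHS]big_mkcond; apply: eq_bigr => c _; rewrite inE; case: ifP.
set D := #|[set c | _]|; set C := #|{: {ffun T -> 'rV['F_2]_w}}|.
(* With N >= l + w the exponential is at least 1 and the trivial bound suffices. Otherwise N - l - w
   is negative, so lowering the tilt from ln 2 to [eta] only increases the bound. *)
have [le_lN|lt_Nl] := leqP (l + w) #|keys_near a l s|.
  apply: le_trans (_ : C%:R <= _); first by rewrite ler_nat; apply: max_card.
  by rewrite ler_peMr // -[leLHS]expR0 ler_expR mulr_ge0 // subr_ge0 ler_nat.
have pow2 k : expR (ln 2 * k%:R) = 2 ^+ k :> R.
  by rewrite mulrC expRM_natl lnK // posrE.
apply: le_trans (_ : C%:R * expR (ln 2 * (#|keys_near a l s|%:R - (l + w)%:R)) <= _).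
  rewrite mulrBr expRD expRN !pow2 mulrA ler_pdivlMr ?exprn_gt0 //.
  by rewrite -!natrX -!natrM ler_nat [(C * _)%N]mulnC; apply: dependent_on_count.
rewrite ler_wpM2l // ler_expR ler_wnM2r // subr_le0 ler_nat ltnW //.
Qed.

(** The summand is a product over keys of functions of their own positions, so the sum factors: [y]
    contributes the first two factors, each of the other n keys one factor of the power. *)
Lemma sum_starts_prod (a l n : nat) (eta : R) : 0 <= eta -> #|T| = n.+1 ->
  \sum_(s : {ffun T -> 'I_M})
    ((starts_between a l (s y))%:R * expR (eta * #|keys_near a l s|%:R)) <=
  l.+1%:R * expR eta * (M%:R + l.+1%:R * (expR eta - 1)) ^+ n :> R.
Proof.
move=> eta0 cardT.
pose G (i : 'I_M) : R := if starts_between a l i then expR eta else 1.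
pose F x (i : 'I_M) : R := if x == y then (starts_between a l i)%:R * G i else G i.
have -> : \sum_(s : {ffun T -> 'I_M})
      ((starts_between a l (s y))%:R * expR (eta * #|keys_near a l s|%:R))
    = \sum_(s : {ffun T -> 'I_M}) \prod_x F x (s x).
  apply: eq_bigr => s _.
  rewrite (bigD1 y) //= /F eqxx -mulrA; congr (_ * _).
  rewrite (eq_bigr (fun x => G (s x))) => [|x /negbTE ->] //.
  transitivity (\prod_x G (s x)); last by rewrite (bigD1 y).
  rewrite mulrC expRM_natl -prodr_const [LHS]big_mkcond.
  by apply: eq_bigr => x _; rewrite inE.
rewrite -bigA_distr_bigA (bigD1 y) //=.
have e1 : 1 <= expR eta by rewrite -expR0 ler_expR.
have cnt : \sum_(i < M) (starts_between a l i)%:R <= l.+1%:R :> R.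
  rewrite -natr_sum ler_nat; apply: leq_trans (card_starts_between M a l).
  rewrite -sum1_card [X in (_ <= X)%N]big_mkcond leq_sum // => i _.
  by rewrite inE; case: ifP.
apply: ler_pM.
- rewrite sumr_ge0 // => i _; rewrite /F eqxx /G mulr_ge0 //.
  by case: ifP => // _; exact: expR_ge0.
- rewrite prodr_ge0 // => x xy; rewrite sumr_ge0 // => i _.
  by rewrite /F (negbTE xy) /G; case: ifP => // _; exact: expR_ge0.
- apply: le_trans (ler_wpM2r (expR_ge0 eta) cnt).
  rewrite mulr_suml ler_sum // => i _; rewrite /F eqxx /G.
  by case: ifP => _; rewrite ?mul0r.
rewrite (eq_bigr (fun=> \sum_i G i)) => [|x /negbTE xy]; last first.
  by apply: eq_bigr => i _; rewrite /F xy.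
rewrite prodr_const cardC1 cardT /= lerXn2r // ?nnegrE.
- by rewrite sumr_ge0 // => i _; rewrite /G; case: ifP => // _; exact: expR_ge0.
- by rewrite addr_ge0 // mulr_ge0 // subr_ge0.
rewrite (eq_bigr (fun i => 1 + (starts_between a l i)%:R * (expR eta - 1))).
  rewrite big_split /= sumr_const card_ord lerD2l -mulr_suml.
  by rewrite ler_wpM2r // subr_ge0.
by move=> i _; rewrite /G; case: ifP => _; rewrite ?mul0r ?mul1r ?addr0 // addrC subrK.
Qed.

(** The bound for a pair (a, l) does not depend on a, so the M choices of a cancel one factor of
    M^(n+1); the others normalise the n factors of the keys other than [y]. *)
Lemma dependent_sum (n : nat) (eta : nat -> R) :
  (forall l, 0 <= eta l <= ln 2) -> #|T| = n.+1 ->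
  (\sum_(s : {ffun T -> 'I_M}) \sum_(c : {ffun T -> 'rV['F_2]_w}) (dependent s c)%:R)
    / (M%:R ^+ n.+1 * #|{: {ffun T -> 'rV['F_2]_w}}|%:R) <=
  \sum_(l < M) l.+1%:R * expR (eta l)
    * (1 + l.+1%:R / M%:R * (expR (eta l) - 1)) ^+ n
    * expR (- (eta l * (l + w)%:R)) :> R.
Proof.
move=> etaP cardT; set C := #|{: {ffun T -> 'rV['F_2]_w}}|.
have C0 : 0 < C%:R :> R.
  by rewrite ltr0n; apply/card_gt0P; exists [ffun=> 0].
have M0 : 0 < M%:R :> R by rewrite ltr0n.
rewrite ler_pdivrMr ?mulr_gt0 ?exprn_gt0 //.
pose B (a l : nat) s : R := (starts_between a l (s y))%:R
    * expR (eta l * (#|keys_near a l s|%:R - (l + w)%:R)).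
have step1 s : \sum_(c : {ffun T -> 'rV['F_2]_w}) (dependent s c)%:R <=
    \sum_(a < M) \sum_(l < M) C%:R * B a l s.
  apply: le_trans (_ : \sum_(c : {ffun T -> 'rV['F_2]_w})
    \sum_(a < M) \sum_(l < M) (dependent_on a l s c)%:R <= _).
    apply: ler_sum => c _.
    have [/dependent_onP[a [l dal]]|_] := boolP (dependent s c); last first.
      by rewrite sumr_ge0 // => a _; rewrite sumr_ge0.
    rewrite (bigD1 a) //= (bigD1 l) //= dal -addrA lerDl addr_ge0 //.
      by rewrite sumr_ge0.
    by rewrite sumr_ge0 // => a' _; rewrite sumr_ge0.
  rewrite exchange_big /=; apply: ler_sum => a _.
  rewrite exchange_big /=; apply: ler_sum => l _.
  exact: dependent_on_sum.
apply: le_trans (ler_sum _ (fun s _ => step1 s)) _.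
rewrite exchange_big /=.
pose bnd (l : nat) : R := l.+1%:R * expR (eta l)
  * (M%:R + l.+1%:R * (expR (eta l) - 1)) ^+ n * expR (- (eta l * (l + w)%:R)).
apply: le_trans (_ : \sum_(a < M) \sum_(l < M) C%:R * bnd l <= _).
  apply: ler_sum => a _; rewrite exchange_big /=; apply: ler_sum => l _.
  rewrite -mulr_sumr ler_wpM2l //.
  rewrite (eq_bigr (fun s => (starts_between a l (s y))%:R
      * expR (eta l * #|keys_near a l s|%:R) * expR (- (eta l * (l + w)%:R)))); last first.
    by move=> s _; rewrite /B mulrBr expRD mulrA.
  rewrite -mulr_suml ler_wpM2r ?expR_ge0 //; apply: sum_starts_prod => //.
  by case/andP: (etaP l).
rewrite sumr_const card_ord -[leLHS]mulr_natl -mulr_sumr mulrCA.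
rewrite [leRHS]mulrA [leRHS]mulrC ler_wpM2l // exprS [leRHS]mulrCA.
rewrite ler_wpM2l // mulr_suml.
apply: ler_sum => l _; rewrite le_eqVlt; apply/orP; left; apply/eqP.
rewrite /bnd.
have -> : M%:R + l.+1%:R * (expR (eta l) - 1)
    = M%:R * (1 + l.+1%:R / M%:R * (expR (eta l) - 1)).
  by field; rewrite gt_eqF.
by rewrite exprMn; ring.
Qed.

End Dependent.

(** * Choice of the tilts and summation over interval lengths *)

Section Tail.
Variable R : realType.
Implicit Types x : R.

(** From 1 - x <= exp(-x), as (1 - x)(1 + x + 2 x^2) = 1 + x^2 (1 - 2 x) >= 1. *)
Lemma expR_le_quad x : 0 <= x <= 1 / 2 -> expR x <= 1 + x + 2 * x ^+ 2.
Proof.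
move=> /andP[x0 x1].
have : 1 - x <= (expR x)^-1 by rewrite -expRN expR_ge1Dx.
rewrite -[leRHS]mul1r ler_pdivlMr ?expR_gt0 // => h.
have x2 : 0 <= x ^+ 2 * (1 - 2 * x) by rewrite mulr_ge0 ?sqr_ge0 //; lra.
by rewrite -(ler_pM2r (_ : 0 < 1 - x)); lra.
Qed.

(** From 1 + x <= exp(x), as (1 + x)(1 - x + x^2) = 1 + x^3. *)
Lemma expRN_le_quad x : 0 <= x -> expR (- x) <= 1 - x + x ^+ 2.
Proof.
move=> x0; rewrite expRN -[leLHS]mul1r ler_pdivrMr ?expR_gt0 //.
have x3 : 0 <= x ^+ 3 by rewrite exprn_ge0.
have e1 : (1 - x + x ^+ 2) * (1 + x) <= (1 - x + x ^+ 2) * expR x.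
  by rewrite ler_wpM2l ?expR_ge1Dx //; have := sqr_ge0 (x - 1 / 2); lra.
apply: le_trans e1; lra.
Qed.

Lemma half_le_ln2 : 1 / 2 <= ln 2 :> R.
Proof.
have h : ln (1 + (- (1 / 2))) <= - (1 / 2) :> R by apply: le_ln1Dx; lra.
have -> : ln 2 = - ln (1 + (- (1 / 2))) :> R; last by lra.
by rewrite -lnV ?posrE; [congr ln; field | lra].
Qed.

Lemma ln2_le1 : ln 2 <= 1 :> R.
Proof. by have := @le_ln1Dx R 1; apply; lra. Qed.

(* lam is the probability that a key starts in the interval, and W = w - 1, so
   that lam (1 + eps) n + (1 - lam) W is the width l + w of the covered part.
   The tilt eps / 4 uses the variance bound lam n.  When lam > 1/2 and n is
   small, one has to count the keys outside the interval instead, whose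
   variance (1 - lam) n is beaten by (1 - lam) W for the tilt W / (4 n). *)
Lemma exp_moment_exponent (eps lam n W : R) :
  0 < eps < 1 / 2 -> 0 <= lam <= 1 -> 0 < n -> 0 <= W <= 3 / 2 * n ->
  exists eta q, [/\ 0 <= eta <= 1 / 2, 1 + lam * (expR eta - 1) <= expR q
    & n * q - eta * (lam * (1 + eps) * n + (1 - lam) * W)
        <= - ((eps ^+ 2 * (lam * n) + eps * W) / 32)].
Proof.
move=> /andP[eps0 eps1] /andP[lam0 lam1] n0 /andP[W0 W1].
have [small|/norP[]] := boolP ((lam <= 1 / 2) || (W <= eps * n)).
  (* The exponent is then - eps^2 lam n / 8 - eps (1 - lam) W / 4. For lam <= 1/2 the second term
     yields the W part of the claim; for lam > 1/2 and W <= eps n the first one does. *)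
  exists (eps / 4), (lam * (eps / 4 + 2 * (eps / 4) ^+ 2)); split.
  - by apply/andP; split; lra.
  - apply: le_trans (expR_ge1Dx _); rewrite lerD2l ler_wpM2l //.
    have := @expR_le_quad (eps / 4); lra.
  - have e1 : 0 <= eps ^+ 2 * (lam * n).
      by rewrite mulr_ge0 ?sqr_ge0 // mulr_ge0 // ltW.
    have e2 : 0 <= eps * W by rewrite mulr_ge0 // ltW.
    case/orP: small => small.
      have : 0 <= eps * W * (1 / 2 - lam) by rewrite mulr_ge0 // subr_ge0.
      lra.
    have [|lam2] := lerP lam (1 / 2).
      move=> lam2; have : 0 <= eps * W * (1 / 2 - lam) by rewrite mulr_ge0 // subr_ge0.
      lra.
    have e3 : 0 <= eps * lam * (eps * n - W).
      by rewrite mulr_ge0 ?subr_ge0 // mulr_ge0 // ltW.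
    have e4 : 0 <= eps * W * (lam - 1 / 2) by rewrite mulr_ge0 // subr_ge0 ltW.
    have e5 : 0 <= eps * W * (1 - lam) by rewrite mulr_ge0 // subr_ge0.
    lra.
rewrite -!ltNge => lam2 nW.
pose eta := W / (4 * n).
have etan : eta * n = W / 4 by rewrite /eta; field; rewrite gt_eqF.
have eta0 : 0 <= eta by rewrite /eta divr_ge0 // mulr_ge0 // ltW.
have eta1 : eta <= 1 / 2 by rewrite /eta ler_pdivrMr ?mulr_gt0 //; lra.
exists eta, (lam * eta + (1 - lam) * eta ^+ 2); split.
- by rewrite eta0.
(* Factoring out [expR eta] leaves the moment of the indicator of starting outside the interval, at
   tilt [- eta]. *)
- have -> : 1 + lam * (expR eta - 1)
      = expR eta * (1 + (1 - lam) * (expR (- eta) - 1)).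
    by rewrite expRN; field; rewrite gt_eqF ?expR_gt0.
  have -> : lam * eta + (1 - lam) * eta ^+ 2
      = eta + (1 - lam) * (- eta + eta ^+ 2) by ring.
  rewrite expRD ler_wpM2l ?expR_ge0 //.
  apply: le_trans (expR_ge1Dx _); rewrite lerD2l ler_wpM2l ?subr_ge0 //.
  have := expRN_le_quad eta0; lra.
- have -> : n * (lam * eta + (1 - lam) * eta ^+ 2)
      - eta * (lam * (1 + eps) * n + (1 - lam) * W)
    = (1 - lam) * eta * (eta * n - W) - lam * eps * (eta * n) by ring.
  (* With eta n = W / 4 the last term is lam eps W / 4; as W > eps n and lam > 1/2, it pays for both
     terms of the claim. *)
  rewrite etan.
  have e1 : 0 <= (1 - lam) * eta * W.
    by rewrite mulr_ge0 // mulr_ge0 // subr_ge0.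
  have e2 : 0 <= eps * W * (lam - 1 / 2).
    by rewrite mulr_ge0 ?subr_ge0 ?(ltW lam2) // mulr_ge0 // ltW.
  have e3 : 0 <= eps * lam * (W - eps * n).
    by rewrite mulr_ge0 ?subr_ge0 ?(ltW nW) // mulr_ge0 // ltW.
  have e4 : 0 <= eps * W * (1 - lam).
    by rewrite mulr_ge0 ?subr_ge0 // mulr_ge0 // ltW.
  lra.
Qed.

(** Telescoping: exp(x) >= 1 + x gives x exp(-(l+1) x) <= exp(-l x) - exp(-(l+1) x). *)
Lemma sum_expR_le x N : 0 < x -> \sum_(l < N) expR (- (l.+1%:R * x)) <= x^-1.
Proof.
move=> x0; rewrite -[leRHS]mul1r ler_pdivlMr //.
apply: le_trans (_ : 1 - expR (- (N%:R * x)) <= _); last first.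
  by rewrite gerBl expR_ge0.
elim: N => [|N IH]; first by rewrite big_ord0 !mul0r oppr0 expR0 subrr.
rewrite big_ord_recr /= mulrDl.
move: IH; have -> : expR (- (N%:R * x)) = expR x * expR (- (N.+1%:R * x)).
  by rewrite -expRD; congr expR; rewrite -natr1; ring.
set F := expR (- _); set E := expR x => IH.
have : 0 <= F * (E - (1 + x)) by rewrite mulr_ge0 ?expR_ge0 // subr_ge0 expR_ge1Dx.
lra.
Qed.

(* From k x <= expR (k x). *)
Lemma sum_muln_expR_le x N : 0 < x ->
  \sum_(l < N) l.+1%:R * expR (- (l.+1%:R * (2 * x))) <= x ^- 2.
Proof.
move=> x0; apply: le_trans (_ : \sum_(l < N) x^-1 * expR (- (l.+1%:R * x)) <= _).
  apply: ler_sum => l _.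
  have -> : - (l.+1%:R * (2 * x)) = - (l.+1%:R * x) + - (l.+1%:R * x) by ring.
  rewrite expRD mulrA ler_wpM2r ?expR_ge0 //.
  rewrite expRN ler_pdivrMr ?expR_gt0 // mulrC ler_pdivlMr //.
  by apply: le_trans (expR_ge1Dx _); rewrite lerDr.
rewrite -mulr_sumr exprS expr1 invfM ler_wpM2l ?invr_ge0 ?(ltW x0) //.
exact: sum_expR_le.
Qed.

Lemma dependent_prob_le (m w n : nat) (T : finType) (y : T) (eps : R) :
  0 < eps < 1 / 2 -> m%:R = (1 + eps) * n%:R -> (1 < w <= m)%N ->
  #|T| = n.+1 ->
  (\sum_(s : {ffun T -> 'I_(m - w).+1}) \sum_(c : {ffun T -> 'rV['F_2]_w})
     (dependent y s c)%:R)
    / ((m - w).+1%:R ^+ n.+1 * #|{: {ffun T -> 'rV['F_2]_w}}|%:R)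
  <= 2 ^+ 15 / eps ^+ 4 * expR (- (eps * w%:R / 64)).
Proof.
move=> /andP[eps0 eps1] mn /andP[w1 wm] cardT.
set M := (m - w).+1.
have M0 : 0 < M%:R :> R by rewrite ltr0n.
have w1R : 2 <= w%:R :> R by rewrite (ler_nat R 2).
have wmR : w%:R <= m%:R :> R by rewrite ler_nat.
have n0 : 0 < n%:R :> R.
  have m0 : 0 < m%:R :> R by lra.
  by move: m0; rewrite mn pmulr_rgt0 //; lra.
have ME : M%:R = (1 + eps) * n%:R - (w%:R - 1).
  by rewrite -mn /M -natr1 natrB //; ring.
have /choice[eta etaP] : forall l : nat, exists eta : R, 0 <= eta <= 1 / 2 /\
    ((l < M)%N -> (1 + l.+1%:R / M%:R * (expR eta - 1)) ^+ n
        * expR (- (eta * (l + w)%:R))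
      <= expR (- (l.+1%:R * (2 * (eps ^+ 2 / 128)))) * expR (- (eps * w%:R / 64))).
  move=> l; have [lM|_] := ltnP l M; last by exists 0; split=> //; lra.
  pose lam : R := l.+1%:R / M%:R.
  have lamM : lam * M%:R = l.+1%:R by rewrite /lam mulfVK // gt_eqF.
  have lam0 : 0 <= lam by rewrite divr_ge0.
  have lam1 : lam <= 1 by rewrite ler_pdivrMr // mul1r ler_nat.
  have [||||eta [q [eta01 hq hexp]]] := @exp_moment_exponent eps lam n%:R (w%:R - 1).
  - by rewrite eps0.
  - by rewrite lam0.
  - by [].
  - have : 0 <= (1 / 2 - eps) * n%:R by rewrite mulr_ge0 ?subr_ge0 ?ltW.
    by move=> ?; apply/andP; split; lra.
  exists eta; split=> // _.
  have lw : (l + w)%:R = lam * (1 + eps) * n%:R + (1 - lam) * (w%:R - 1) :> R.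
    have -> : (l + w)%:R = l.+1%:R + (w%:R - 1) :> R by rewrite natrD -natr1; ring.
    by rewrite -lamM ME; ring.
  have base0 : 0 <= 1 + lam * (expR eta - 1).
    rewrite addr_ge0 // mulr_ge0 // subr_ge0 -[leLHS]expR0 ler_expR.
    by case/andP: eta01.
  apply: le_trans (_ : expR q ^+ n * expR (- (eta * (l + w)%:R)) <= _).
    by rewrite ler_wpM2r ?expR_ge0 // lerXn2r // nnegrE expR_ge0.
  rewrite -expRM_natl -!expRD ler_expR lw.
  apply: le_trans hexp _.
  (* Since l + 1 = lam M <= 2 lam n and w - 1 >= w / 2, the denominator 32 becomes 64; eps^2 / 64 is
     written 2 (eps^2 / 128) to suit [sum_muln_expR_le]. *)
  have k0 : 0 <= l.+1%:R :> R by [].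
  have kn : l.+1%:R <= 2 * (lam * n%:R).
    rewrite -lamM mulrCA ler_wpM2l // ME.
    have : 0 <= (1 / 2 - eps) * n%:R by rewrite mulr_ge0 ?subr_ge0 ?ltW.
    lra.
  have e1 : 0 <= eps ^+ 2 * (2 * (lam * n%:R) - l.+1%:R).
    by rewrite mulr_ge0 ?sqr_ge0 // subr_ge0.
  have e2 : 0 <= eps * (w%:R - 2) by rewrite mulr_ge0 ?subr_ge0 // ltW.
  lra.
have etaln l : 0 <= eta l <= ln 2.
  by have [/andP[e0 e1] _] := etaP l; rewrite e0 (le_trans e1) ?half_le_ln2.
apply: le_trans (dependent_sum wm y etaln cardT) _.
set x := eps ^+ 2 / 128 in etaP.
have x0 : 0 < x by rewrite divr_gt0 // exprn_gt0.
apply: le_trans (_ : \sum_(l < M) (2 * expR (- (eps * w%:R / 64)))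
    * (l.+1%:R * expR (- (l.+1%:R * (2 * x)))) <= _).
  apply: ler_sum => l _; have [/andP[e0 e1] /(_ (ltn_ord l)) hl] := etaP l.
  set Ew := expR (- (eps * w%:R / 64)) in hl *.
  set El := expR (- (l.+1%:R * (2 * x))) in hl *.
  rewrite -!mulrA.
  have el : expR (eta l) <= 2.
    by rewrite -[leRHS]lnK ?posrE // ler_expR; case/andP: (etaln l).
  apply: le_trans (_ : l.+1%:R * (2 * (El * Ew)) <= _).
    rewrite ler_wpM2l //; apply: ler_pM; rewrite ?expR_ge0 //.
      rewrite mulr_ge0 ?expR_ge0 // exprn_ge0 // addr_ge0 //.
      rewrite mulr_ge0 // mulr_ge0 ?invr_ge0 //.
      by rewrite subr_ge0 -[leLHS]expR0 ler_expR.
    by move: hl; rewrite -mulrA.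
  rewrite le_eqVlt; apply/orP; left; apply/eqP.
  by ring.
rewrite -mulr_sumr.
(* x^-2 is 2^14 / eps^4, and the remaining factor 2 bounds [expR (eta l)]. *)
have -> : 2 ^+ 15 / eps ^+ 4 * expR (- (eps * w%:R / 64))
    = 2 * expR (- (eps * w%:R / 64)) * x ^- 2.
  by rewrite /x; field; rewrite gt_eqF.
by rewrite ler_wpM2l ?mulr_ge0 ?expR_ge0 // sum_muln_expR_le.
Qed.

End Tail.

(** * Bounding the false positive rate by the probability of dependence *)

Section FalsePositiveRate.
Variables (R : realType) (m w r : nat) (K : finType).
Implicit Type h : {ffun K -> hash m w}.

(** [None] stands for the queried key. In characteristic 2, a row added to a subset sum equal to it
    gives 0. *)
Lemma in_span_dependent h (sc : hash m w)
    (s : {ffun option K -> 'I_(m - w).+1}) (c : {ffun option K -> 'rV['F_2]_w}) :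
  (forall x, h x = (s (Some x), c (Some x))) -> sc = (s None, c None) ->
  in_span h (hvec sc) -> dependent None s c.
Proof.
move=> hE scE /existsP[A /eqP spanA]; apply/existsP; exists (None |: Some @: A).
rewrite finset.setU11 /= big_setU1 /=; last by apply/imsetP => -[].
rewrite big_imset /=; last by move=> ? ? _ _ [].
rewrite -scE spanA -big_split big1 // => x _; rewrite /= -hE.
apply/rowP => j; rewrite !mxE.
by case: (\sum_(k < w | _) _) => -[|[|]] // ?; apply/val_inj.
Qed.

(** Hash values for K and one fresh key correspond bijectively to positions and coefficients on
    [option K]; this regrouping lets the positions be fixed first. *)
Lemma sum_in_span_le :
  \sum_(h : {ffun K -> hash m w}) \sum_(sc : hash m w) (in_span h (hvec sc))%:R <=
  \sum_(s : {ffun option K -> 'I_(m - w).+1})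
    \sum_(c : {ffun option K -> 'rV['F_2]_w}) (dependent None s c)%:R :> R.
Proof.
pose tohash (p : {ffun option K -> 'I_(m - w).+1} * {ffun option K -> 'rV['F_2]_w})
    : {ffun K -> hash m w} * hash m w :=
  ([ffun x => (p.1 (Some x), p.2 (Some x))], (p.1 None, p.2 None)).
pose ofhash (q : {ffun K -> hash m w} * hash m w) :=
  ([ffun o => (if o is Some x then q.1 x else q.2).1],
   [ffun o => (if o is Some x then q.1 x else q.2).2])
  : {ffun option K -> 'I_(m - w).+1} * {ffun option K -> 'rV['F_2]_w}.
have tohash_bij : bijective tohash.
  exists ofhash.
    move=> [s c]; rewrite /ofhash /tohash /=.
    by congr pair; apply/ffunP => -[x|]; rewrite !ffunE.
  move=> [h [s c]]; rewrite /ofhash /tohash /=; congr pair; last by rewrite !ffunE.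
  by apply/ffunP => x; rewrite !ffunE -surjective_pairing.
rewrite !pair_big /= (reindex tohash) /=; last exact: onW_bij.
apply: ler_sum => -[s c] _; rewrite ler_nat /=.
case: (boolP (in_span _ _)) => //= /in_span_dependent ->  // x.
by rewrite ffunE.
Qed.

Definition query_rate h (sc : hash m w) : R :=
  unifPr R (solutions r h) (fun Z => query Z (hvec sc)).

Lemma query_rateE h sc : query_rate h sc =
  #|[set Z in solutions r h | query Z (hvec sc)]|%:R / #|solutions r h|%:R.
Proof.
rewrite /query_rate /unifPr /unifE -natr_sum; congr (_%:R / _).
rewrite -sum1_card big_mkcond [RHS]big_mkcond; apply: eq_bigr => Z _.
by rewrite inE; case: (_ \in _); case: query.
Qed.

Lemma query_rate_ge h sc : 2 ^- r <= query_rate h sc.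
Proof.
rewrite query_rateE ler_pdivlMr ?ltr0n ?solutions_gt0 //.
rewrite mulrC ler_pdivrMr ?exprn_gt0 // -natrX -natrM ler_nat.
exact: query_count_lb.
Qed.

Lemma query_rate_le h sc :
  query_rate h sc <= 2 ^- r + (in_span h (hvec sc))%:R.
Proof.
have sol0 : 0 < #|solutions r h|%:R :> R by rewrite ltr0n solutions_gt0.
rewrite query_rateE; have [_|nspan] := boolP (in_span _ _).
  apply: le_trans (_ : 1 <= _); last by rewrite lerDr invr_ge0 exprn_ge0.
  rewrite ler_pdivrMr // mul1r ler_nat; apply/subset_leq_card/fintype.subsetP => Z.
  by rewrite inE => /andP[].
rewrite addr0 ler_pdivrMr // mulrC ler_pdivlMr ?exprn_gt0 //.
by rewrite -natrX -natrM ler_nat; apply: query_count_ub.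
Qed.

Let rate : R := unifE [set: {ffun K -> hash m w}] (fun h =>
  unifE (solutions r h) (fun Z => fpr_given R w Z)).

(** The averages over Z and over the fresh hash value are interchanged, so that the rate can be
    bounded for fixed hash values. *)
Lemma rateE :
  rate = (\sum_(h : {ffun K -> hash m w}) \sum_(sc : hash m w) query_rate h sc)
  / (#|{: {ffun K -> hash m w}}|%:R * #|hash m w|%:R).
Proof.
rewrite /rate /unifE cardsT invfM mulrA mulrAC; congr (_ / _).
rewrite mulr_suml; apply: eq_big => [h|h _]; first by rewrite inE.
rewrite /fpr_given /unifPr /unifE -mulr_suml exchange_big /= mulrAC cardsT.
congr (_ / _); rewrite mulr_suml; apply: eq_big => [sc|sc _]; first by rewrite inE.
by [].
Qed.

Lemma card_hash_gt0 :
  0 < #|{: {ffun K -> hash m w}}|%:R * #|hash m w|%:R :> R.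
Proof.
by rewrite -natrM ltr0n muln_gt0; apply/andP; split; apply/card_gt0P;
  [exists [ffun=> (ord0, 0)] | exists (ord0, 0)].
Qed.

Lemma rate_ge : 2 ^- r <= rate.
Proof.
rewrite rateE ler_pdivlMr ?card_hash_gt0 //.
rewrite mulrC -mulrA mulr_natl -sumr_const; apply: ler_sum => h _.
by rewrite mulr_natl -sumr_const; apply: ler_sum => sc _; apply: query_rate_ge.
Qed.

Lemma rate_le : rate <= 2 ^- r
  + (\sum_(s : {ffun option K -> 'I_(m - w).+1})
       \sum_(c : {ffun option K -> 'rV['F_2]_w}) (dependent None s c)%:R)
    / ((m - w).+1%:R ^+ #|K|.+1 * #|{: {ffun option K -> 'rV['F_2]_w}}|%:R).
Proof.
have -> : (m - w).+1%:R ^+ #|K|.+1 * #|{: {ffun option K -> 'rV['F_2]_w}}|%:R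
    = #|{: {ffun K -> hash m w}}|%:R * #|hash m w|%:R :> R.
  rewrite !card_ffun card_option card_prod card_ord -natrX -!natrM; congr _%:R.
  by rewrite -expnMn -expnSr.
rewrite rateE; set N := #|_|%:R * #|_|%:R.
have N0 : 0 < N := card_hash_gt0.
rewrite ler_pdivrMr // mulrDl divfK ?gt_eqF //.
apply: le_trans (lerD (lexx _) sum_in_span_le).
rewrite mulrC /N -mulrA mulr_natl -sumr_const -big_split; apply: ler_sum => h _ /=.
rewrite mulr_natl -sumr_const -big_split; apply: ler_sum => sc _ /=.
exact: query_rate_le.
Qed.

End FalsePositiveRate.

(** * The constant, rounding to [r], and the space overhead *)

Section Conclusion.
Variable R : realType.
Implicit Types eps phi x : R.

Lemma dependent_prob_small eps (w r : nat) :
  0 < eps < 1 / 2 -> (0 < r)%N ->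
  eps * w%:R > 2 ^+ 11 * Num.max (log2 (w%:R : R)) r%:R ->
  2 ^+ 15 / eps ^+ 4 * expR (- (eps * w%:R / 64)) <= eps / 4 * 2 ^- r.
Proof.
move=> /andP[eps0 eps1] r0 hw.
have r1 : 1 <= r%:R :> R by rewrite ler1n.
have maxr : r%:R <= Num.max (log2 (w%:R : R)) r%:R by rewrite le_max lexx orbT.
have maxw : log2 (w%:R : R) <= Num.max (log2 (w%:R : R)) r%:R by rewrite le_max lexx.
set mx := Num.max _ _ in hw maxr maxw.
have epsw : 2 ^+ 11 <= eps * w%:R by apply: ltW; apply: le_lt_trans hw; lra.
have w0 : 0 < w%:R :> R by rewrite -(pmulr_rgt0 _ eps0); lra.
have w9 : 2 ^+ 9 <= w%:R :> R.
  have : 0 < (1 / 2 - eps) * w%:R by rewrite mulr_gt0 // subr_gt0.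
  lra.
have lnw : ln w%:R <= log2 (w%:R : R).
  rewrite /log2 ler_pdivlMr; last by have := half_le_ln2 R; lra.
  rewrite ler_piMr ?ln2_le1 // ln_ge0 //; lra.
(* 2^11 / 64 = 32, and 32 times the maximum is at least 16 ln w + r; finally e >= 2. *)
have le_exp : expR (- (eps * w%:R / 64)) <= (w%:R ^+ 16)^-1 * 2 ^- r.
  apply: le_trans (_ : expR (- (16%:R * ln w%:R) + - (r%:R * 1)) <= _).
    by rewrite ler_expR; lra.
  rewrite expRD !expRN !expRM_natl lnK ?posrE //.
  apply: ler_wpM2l; first by rewrite invr_ge0 exprn_ge0.
  rewrite lef_pV2 ?posrE ?exprn_gt0 ?expR_gt0 // lerXn2r ?nnegrE ?expR_ge0 //.
  exact: expR_ge1Dx.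
apply: le_trans (ler_wpM2l _ le_exp) _.
  by rewrite divr_ge0 ?exprn_ge0 // ltW.
rewrite mulrA ler_wpM2r ?invr_ge0 ?exprn_ge0 //.
rewrite -mulrA -invfM ler_pdivrMr; last by rewrite mulr_gt0 // exprn_gt0.
(* Five factors w absorb eps^5, and w^2 >= 2^18 beats 4 * 2^15. *)
have -> : eps / 4 * (eps ^+ 4 * w%:R ^+ 16)
    = (eps * w%:R) ^+ 5 * (w%:R ^+ 9 * w%:R ^+ 2) / 4 by ring.
have e1 : 1 <= (eps * w%:R) ^+ 5 by rewrite exprn_ege1 //; lra.
have e2 : 1 <= w%:R ^+ 9 :> R by rewrite exprn_ege1 //; lra.
have e3 : 2 ^+ 9 ^+ 2 <= w%:R ^+ 2 :> R by rewrite lerXn2r ?nnegrE ?exprn_ge0 // ltW.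
rewrite ler_pdivlMr //.
apply: le_trans (_ : 1 * (1 * (2 ^+ 9 ^+ 2)) <= _); first by lra.
by rewrite !ler_pM ?mulr_ge0 ?exprn_ge0.
Qed.

(** Comparison with r + 1 gives the lower bound, with r - 1 the upper one. For r = 1 there is no
    smaller competitor, and x >= 0 gives only r <= x + 1. *)
Lemma closest_posint_near x (r : nat) : 0 <= x -> closest_posint x r ->
  x - 1 / 2 <= r%:R <= x + 1.
Proof.
move=> x0 [r0 rmin].
have h1 := rmin r.+1 isT; rewrite -natr1 in h1.
have lo : x - 1 / 2 <= r%:R.
  have [|xr] := lerP x r%:R; first by lra.
  by move: h1; rewrite ltr0_norm; last lra; case: ger0P => ? ?; lra.
rewrite lo /=; case: r r0 {h1 lo} rmin => [//|[|r]] _ rmin; first by lra.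
have := rmin r.+1 isT; rewrite -[in r.+2%:R]natr1.
have [|] := lerP r.+1%:R x; first by lra.
by move=> xr; rewrite !gtr0_norm; lra.
Qed.

Lemma rate_conclusion eps phi f (r : nat) :
  0 < eps < 1 / 2 -> 0 < phi <= 1 -> closest_posint (- log2 phi) r ->
  2 ^- r <= f <= 2 ^- r * (1 + eps / 4) ->
  [/\ phi / 2 <= f <= 2 * phi, 0 < opt f
    & (1 + eps) * r%:R <= (1 + 2 * eps) * opt f].
Proof.
move=> /andP[eps0 eps1] /andP[phi0 phi1] rP /andP[flo fhi].
have r1 : 1 <= r%:R :> R by rewrite ler1n; case: rP.
have ln2h := half_le_ln2 R.
have ln20 : 0 < ln 2 :> R by lra.
set x := - log2 phi in rP.
have x0 : 0 <= x by rewrite /x /log2 -mulNr divr_ge0 // ?oppr_ge0 ?ln_le0 // ltW.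
have /andP[rlo rhi] := closest_posint_near x0 rP.
have phiE : phi = expR (- (x * ln 2)).
  by rewrite /x /log2 mulNr opprK divfK ?gt_eqF // lnK // posrE.
have pE : 2 ^- r = expR (- (r%:R * ln 2)) :> R.
  by rewrite expRN expRM_natl lnK // posrE.
have p0 : 0 < 2 ^- r :> R by rewrite invr_gt0 exprn_gt0.
have f0 : 0 < f by apply: lt_le_trans flo.
have lnf : ln f <= - (r%:R * ln 2) + eps / 4.
  apply: le_trans (_ : ln (2 ^- r * (1 + eps / 4)) <= _).
    by rewrite ler_ln ?posrE // mulr_gt0 //; lra.
  rewrite lnM ?posrE //; last by lra.
  by rewrite pE expRK lerD2l; apply: le_ln1Dx; lra.
(* Dividing eps / 4 by ln 2 >= 1/2 costs at most eps / 2. *)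
have optf : r%:R - eps / 2 <= opt f.
  rewrite /opt /log2 -[leRHS]mulNr ler_pdivlMr //.
  have : 0 <= eps * (ln 2 - 1 / 2) by rewrite mulr_ge0 ?subr_ge0 // ltW.
  lra.
split.
- apply/andP; split.
    apply: le_trans flo; rewrite ler_pdivrMr //.
    have -> : 2 ^- r * 2 = expR (- (r%:R * ln 2) + ln 2) :> R.
      by rewrite expRD lnK ?posrE // pE.
    rewrite phiE ler_expR.
    have : 0 <= (x + 1 - r%:R) * ln 2 by rewrite mulr_ge0 ?subr_ge0 // ltW.
    lra.
  apply: le_trans fhi _.
  (* [q] is the square root of 2, the loss from r >= x - 1/2. With 1 + eps / 4 <= 9/8 the total loss
     is at most (3/2)(9/8) < 2. *)
  set q := expR (ln 2 / 2) : R.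
  have q0 : 0 <= q by exact: expR_ge0.
  have q2 : q ^+ 2 = 2.
    by rewrite -expRM_natl mulrCA divff // mulr1 lnK // posrE.
  have q32 : q <= 3 / 2.
    rewrite leNgt; apply/negP => hq.
    by have : 0 < (q - 3 / 2) ^+ 2 + 3 * (q - 3 / 2); [nra|lra].
  have pq : 2 ^- r <= phi * q.
    rewrite pE phiE -expRD ler_expR.
    have : 0 <= (r%:R - (x - 1 / 2)) * ln 2 by rewrite mulr_ge0 ?subr_ge0 // ltW.
    lra.
  apply: le_trans (_ : (phi * (3 / 2)) * (9 / 8) <= _); last by lra.
  apply: ler_pM; [exact: ltW|lra| |lra].
  by apply: le_trans pq _; rewrite ler_wpM2l // ltW.
- lra.
(* The difference of the two sides is eps (r - 1/2 - eps), nonnegative as r >= 1 and eps < 1/2. *)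
- apply: le_trans (_ : (1 + 2 * eps) * (r%:R - eps / 2) <= _); last first.
    by rewrite ler_wpM2l //; lra.
  have : 0 <= eps * (r%:R - 1) by rewrite mulr_ge0 ?subr_ge0 // ltW.
  have : 0 <= eps * (1 / 2 - eps) by rewrite mulr_ge0 ?subr_ge0 // ltW.
  lra.
Qed.

End Conclusion.

Theorem theorem4p1 (R : realType) :
  exists C : R, 0 < C /\
    forall (eps phi : R) (r : nat),
      0 < eps < 1 / 2 ->
      0 < phi <= 1 ->
      closest_posint (- log2 phi) r ->
    forall (w n m : nat),
      eps * w%:R > C * Num.max (log2 (w%:R : R)) r%:R ->
      m%:R = (1 + eps) * n%:R ->
      (w <= m)%N ->
    forall (U : choiceType) (S : {fset U}),
      #|` S|%fset = n ->
      (exists y : U, y \notin S) ->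
      let f := fpr R S m w r in
      [/\ phi / 2 <= f <= 2 * phi,
          0 < opt f
        & overhead n m r f <= 2 * eps].
Proof.
exists (2 ^+ 11); split; first by rewrite exprn_gt0.
move=> eps phi r epsP phiP rP w n m hw mn wm U S cardS _ f.
have r0 : (0 < r)%N by case: rP.
have small := dependent_prob_small epsP r0 hw.
have w1 : (1 < w)%N.
  rewrite -(ltr_nat R) ltNge; apply/negP => w1.
  have /andP[eps0 eps1] := epsP.
  have : r%:R <= Num.max (log2 (w%:R : R)) r%:R by rewrite le_max lexx orbT.
  have : 1 <= r%:R :> R by rewrite ler1n.
  have : 0 <= eps * (1 - w%:R) by rewrite mulr_ge0 ?subr_ge0 // ltW.
  move: hw; lra.
have cardT : #|{: option S}| = n.+1 by rewrite card_option -cardfE cardS.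
have prob := dependent_prob_le None epsP mn (introT andP (conj w1 wm)) cardT.
have fP : 2 ^- r <= f <= 2 ^- r * (1 + eps / 4).
  rewrite rate_ge /=; apply: le_trans (rate_le _ _ _ _ _) _.
  rewrite mulrDr mulr1 lerD2l [leRHS]mulrC; apply: le_trans small.
  by move: prob; rewrite -cardS -cardfE.
have [fphi opt0 ovh] := rate_conclusion epsP phiP rP fP.
split=> //; rewrite /overhead /Defs.space natrM mn.
(* For n = 0 also m = 0, against 1 < w <= m. *)
have n0 : n%:R != 0 :> R.
  apply/eqP => n0; move: wm; rewrite -(ler_nat R) mn n0 mulr0.
  by rewrite (ler_nat R w 0) leqNgt ltnW.
rewrite lerBlDl ler_pdivrMr //; move: ovh.
by have -> : (1 + eps) * n%:R * r%:R / n%:R = (1 + eps) * r%:R by field.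
Qed.
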